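(* Let $\Omega\subset\widehat\Omega$ be finite sets. Let $K$ be a $\frac12$-lazy, ergodic, irreducible, reversible Markov kernel on $\widehat\Omega$ with stationary distribution $\mu$, and let $Q$ be a $\frac12$-lazy, ergodic, irreducible, reversible Markov kernel on $\Omega$ with stationary distribution $\nu$. Fix a map $M:\mathbb{R}^\Omega\to\mathbb{R}^{\widehat\Omega}$ such that for all $f\in\mathbb{R}^\Omega$, $Mf$ is an extension of $f$ (i.e. $(Mf)(x)=f(x)$ for all $x\in\Omega$). Assume that the constant $C_3$ satisfies $$\mathcal{E}_K(Mf,Mf)\le C_3\,\mathcal{E}_Q(f,f)\quad\text{for all }f\in\mathbb{R}^\Omega,$$ and let $C_1=\sup_{y\in\Omega}\frac{\nu(y)}{\mu(y)}$. Then for every $0\le i\le|\Omega|-1$, $$1-\beta_i(Q)\ge\frac1{C_1C_3}\,(1-\beta_i(K)),$$ and $$\alpha(Q)\ge\frac1{C_1C_3}\,\alpha(K).$$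
   Context: A kernel $P$ is $\frac12$-lazy if $P(x,x)\ge\frac12$ for all $x$. For such a reversible irreducible kernel $P$ on a finite set $X$ with stationary distribution $\pi$, $1=\beta_0(P)>\beta_1(P)\ge\cdots\ge\beta_{|X|-1}(P)\ge0$ are its eigenvalues with multiplicity. Define $\mathcal{E}_P(f,f)=\frac12\sum_{x,y\in X}|f(x)-f(y)|^2P(x,y)\pi(x)$, $\|f\|_{2,\pi}^2=\sum_x|f(x)|^2\pi(x)$, and $L_\pi(f)=\sum_{x\in X}|f(x)|^2\log\left(\frac{f(x)^2}{\|f\|_{2,\pi}^2}\right)\pi(x)$ (with $0\log0=0$). The log-Sobolev constant is $\alpha(P)=\inf\mathcal{E}_P(f,f)/L_\pi(f)$ over $f$ with $L_\pi(f)\ne0$. *)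

(* Defs.v *)
From HB Require Import structures.
From mathcomp Require Import all_boot all_order all_algebra.
From mathcomp Require Import polyrcf.
From mathcomp Require Import all_classical all_reals all_analysis.
Import Order.TTheory GRing.Theory Num.Theory.
Import numFieldNormedType.Exports.

Set Implicit Arguments.
Unset Strict Implicit.
Unset Printing Implicit Defensive.

Local Open Scope classical_set_scope.
Local Open Scope ring_scope.

Section FiniteKernels.
Variables (R : realType) (X : finType).
Implicit Types (P : X -> X -> R) (pi : X -> R) (f : X -> R).

Definition markov_kernel P : Prop :=
  (forall x y, 0 <= P x y) /\ (forall x, \sum_y P x y = 1).

Definition lazy P : Prop := forall x, 2^-1 <= P x x.

Definition kernel_mx P : 'M[R]_#|X| :=
  \matrix_(i, j) P (enum_val i) (enum_val j).

Definition kernel_iter P (n : nat) (x y : X) : R :=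
  (kernel_mx P ^+ n) (enum_rank x) (enum_rank y).

Definition irreducible P : Prop :=
  forall x y, exists n : nat, 0 < kernel_iter P n x y.

Definition stationary_distribution P pi : Prop :=
  [/\ forall x, 0 <= pi x, \sum_x pi x = 1
    & forall y, \sum_x pi x * P x y = pi y].

Definition reversible P pi : Prop :=
  forall x y, pi x * P x y = pi y * P y x.

Definition ergodic P pi : Prop :=
  forall x y, kernel_iter P n x y @[n --> \oo] --> pi y.

(* The real eigenvalues, repeated according to their algebraic multiplicity,
   in nonincreasing order; for a reversible irreducible kernel every complex
   eigenvalue is real, so that this list has #|X| elements. *)
Definition eigenvalues P : seq R :=
  let p := char_poly (kernel_mx P) in
  sort (fun a b : R => b <= a) (flatten [seq nseq (mup a p) a | a <- rootsR p]).

Definition beta P (i : nat) : R := (eigenvalues P)`_i.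

Definition dirichlet P pi f : R :=
  2^-1 * \sum_x \sum_y `|f x - f y| ^+ 2 * P x y * pi x.

Definition norm2sq pi f : R := \sum_x `|f x| ^+ 2 * pi x.

(* ln vanishes at 0, and the factor |f x|^2 kills the term anyway, so the
   convention 0 log 0 = 0 is built in. *)
Definition entropy2 pi f : R :=
  \sum_x `|f x| ^+ 2 * ln (f x ^+ 2 / norm2sq pi f) * pi x.

(* Extended-real valued: when X is a singleton no f is admissible and the
   infimum is +oo. *)
Definition log_sobolev P pi : \bar R :=
  ereal_inf [set (dirichlet P pi f / entropy2 pi f)%:E
            | f in [set f : X -> R | entropy2 pi f != 0]].

End FiniteKernels.

(* Main.v *)
(* Since [M] need not be linear, it is replaced by the harmonic extension: a function
   [h] with [laplacian K h = 0] off [Omega] has the least [K]-energy among all functions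
   agreeing with it on [Omega], hence at most that of [M (h|Omega)], and the space of
   such [h] has codimension at most [#|hOmega| - #|Omega|].  Inside it, require [h] to
   be orthogonal to the first [i] eigenfunctions of [K], and [h|Omega] to be orthogonal
   to the eigenfunctions of [Q] of index greater than [i].  These are at most
   [#|hOmega| - 1] linear conditions, so some nonzero [h] satisfies them all, and
     (1 - beta K i) |h|^2 <= E_K(h) <= C3 E_Q(h|Omega)
       <= C3 (1 - beta Q i) |h|Omega|^2 <= C1 C3 (1 - beta Q i) |h|^2.
   For the log-Sobolev constant, the entropy of [f] is the minimum over [c > 0] of the
   integral of the nonnegative function f^2 ln(f^2 / c) - f^2 + c; taking c = |M f|^2
   gives that the entropy of [f] is at most [C1] times that of [M f].
   If [#|Omega| = 1] then [C3] may be nonpositive, but both claims are trivial. *)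
Require Import Defs.
From HB Require Import structures.
From mathcomp Require Import all_boot all_order all_algebra.
From mathcomp Require Import perm polyrcf complex ring lra.
From mathcomp Require Import all_classical all_reals all_analysis.
Import Order.TTheory GRing.Theory Num.Theory.
Import numFieldNormedType.Exports.

Set Implicit Arguments.
Unset Strict Implicit.
Unset Printing Implicit Defensive.

Local Open Scope classical_set_scope.
Local Open Scope ring_scope.

(** * The spectral theorem for real symmetric matrices *)

(** With [P] seen as a matrix of constant polynomials, [P * ('X - A) = ('X - B) * P]; taking
    determinants, the nonzero factor [\det P] cancels. *)
Lemma char_poly_conj (F : fieldType) n (P A B : 'M[F]_n) :
  P \in unitmx -> P *m A = B *m P -> char_poly A = char_poly B.
Proof.
rewrite unitmxE unitfE => Pu PA; rewrite /char_poly.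
have detP : \det (map_mx polyC P) != 0 by rewrite det_map_mx polyC_eq0.
apply: (mulfI detP); rewrite -det_mulmx [RHS]mulrC -det_mulmx; congr (\det _).
by rewrite /char_poly_mx mulmxBr mulmxBl -!map_mxM PA mul_scalar_mx mul_mx_scalar.
Qed.

Lemma char_poly_diag (F : fieldType) n (d : 'rV[F]_n) :
  char_poly (diag_mx d) = \prod_(a <- [seq d 0 i | i : 'I_n]) ('X - a%:P).
Proof.
rewrite char_poly_trig ?diag_mx_is_trig// big_map enumT.
by apply: eq_bigr => i _; rewrite mxE eqxx.
Qed.

Section RealSpectral.
Variable R : rcfType.

Lemma mul_tr_row n (v : 'rV[R]_n) : v *m v^T = (\sum_i v 0 i ^+ 2)%:M.
Proof.
by rewrite [LHS]mx11_scalar mxE; congr _%:M; apply: eq_bigr => i _; rewrite mxE.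
Qed.

Lemma sum_sqr_row_gt0 n (v : 'rV[R]_n) : v != 0 -> 0 < \sum_i v 0 i ^+ 2.
Proof.
move=> v0; rewrite lt_def sumr_ge0 => [|i _]; last exact: sqr_ge0.
rewrite andbT; apply: contra v0.
rewrite psumr_eq0 => [/allP s0|i _]; last exact: sqr_ge0.
apply/eqP/rowP => i; rewrite mxE; apply/eqP.
by rewrite -sqrf_eq0; apply: s0; rewrite mem_index_enum.
Qed.

(** Over [R[i]] the matrix is Hermitian, hence unitarily diagonalizable with real diagonal. One
    diagonal entry is a real root of the characteristic polynomial, and a real root has an
    eigenvector over [R]. *)
Lemma symmetric_eigen n (A : 'M[R]_n.+1) : A^T = A ->
  exists a, exists2 v : 'rV[R]_n.+1, v *m A = a *: v & v != 0.
Proof.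
move=> symA; pose A' : 'M[R[i]]_n.+1 := map_mx (real_complex R) A.
have hA' : A' \is hermsymmx.
  apply: realsym_hermsym.
    apply/is_hermitianmxP; rewrite expr0 scale1r.
    by apply/matrixP => i j; rewrite !mxE -[in LHS]symA mxE.
  by apply/mxOverP => i j; rewrite mxE complex_real.
have /mxOverP rsp := hermitian_spectral_diag_real hA'.
have /orthomx_spectralP eqA' := hermitian_normalmx hA'.
set P := spectralmx A' in eqA'; set sp := spectral_diag A' in eqA' rsp.
have Pu : P \in unitmx by exact: spectral_unit.
have PA : P *m A' = diag_mx sp *m P by rewrite eqA' !mulmxA mulmxV// mul1mx.
have : root (char_poly A') ((complex.Re (sp 0 0))%:C)%C.
  rewrite (char_poly_conj Pu PA) char_poly_diag RRe_real//.
  by rewrite root_prod_XsubC fintype.image_f.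
rewrite -map_char_poly fmorph_root -eigenvalue_root_char.
by case/eigenvalueP => v vA v0; exists (complex.Re (sp 0 0)), v.
Qed.

(* The reflection exchanging the unit vectors [v] and [e_0]. *)
Lemma householder n (v : 'rV[R]_n.+1) : v *m v^T = 1%:M ->
  exists H : 'M[R]_n.+1, [/\ H^T = H, H *m H = 1%:M & delta_mx 0 0 *m H = v].
Proof.
move=> v1; pose e : 'rV[R]_n.+1 := delta_mx 0 0.
have e1 : e *m e^T = 1%:M by rewrite trmx_delta mul_delta_mx [LHS]mx11_scalar mxE.
(* The mirror is orthogonal to [v - e], which degenerates when [v = e]; the identity serves then. *)
have [ve|ve] := eqVneq v e.
  by exists 1%:M; split; rewrite ?trmx1 ?mulmx1.
pose u := v - e; pose t := (e *m v^T) 0 0.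
have ev : e *m v^T = t%:M by exact: mx11_scalar.
have ve' : v *m e^T = t%:M by rewrite -[LHS]trmxK trmx_mul trmxK ev tr_scalar_mx.
pose c := \sum_i u 0 i ^+ 2.
have c0 : c != 0 by rewrite gt_eqF// sum_sqr_row_gt0 // subr_eq0.
have uu : u *m u^T = c%:M by exact: mul_tr_row.
have cE : c = 2 - 2 * t.
  have := congr1 (fun M : 'M[R]_1 => M 0 0) uu.
  rewrite linearB/= mulmxBl !mulmxBr v1 e1 ev ve' !mxE /= !mulr1n => <-; ring.
have eu : e *m u^T = (t - 1)%:M by rewrite linearB/= mulmxBr ev e1 raddfB.
have vE : v = u + e by rewrite subrK.
(* The reflection fixes the orthogonal complement of [u]. It sends [e] to [e + u = v] because
   [c = 2 - 2 * t] makes the coefficient [2 / c * (t - 1)] equal to [-1]. *)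
clearbody u c; exists (1%:M - (2 / c) *: (u^T *m u)); split.
- by rewrite linearB/= linearZ/= trmx_mul trmxK trmx1.
- have WW : u^T *m u *m (u^T *m u) = c *: (u^T *m u).
    by rewrite mulmxA -(mulmxA u^T) uu mul_mx_scalar -scalemxAl.
  rewrite mulmxBl mul1mx mulmxBr mulmx1 -scalemxAl -scalemxAr WW !scalerA.
  have -> : 2 / c * (2 / c) * c = 2 / c + 2 / c by field.
  by rewrite scalerDl opprB addrK subrK.
- rewrite mulmxBr mulmx1 -scalemxAr mulmxA eu mul_scalar_mx scalerA.
  rewrite [X in X *: _](_ : _ = -1); first by rewrite scaleN1r opprK addrC vE.
  by rewrite [t - 1](_ : _ = - c / 2); [field | rewrite cE; field].
Qed.

(** Deflation: conjugating by the reflection that takes [e_0] to a unit eigenvector clears the first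
    row, and by symmetry the first column, off the diagonal. Induction handles the remaining
    block. *)
Lemma symmetric_spectral n (A : 'M[R]_n) : A^T = A ->
  exists O : 'M[R]_n, exists2 d : 'rV[R]_n,
    O *m O^T = 1%:M & O *m A = diag_mx d *m O.
Proof.
elim: n A => [|n IHn] A symA.
  by exists 1%:M, 0; apply/matrixP => -[].
have [a [v va v0]] := symmetric_eigen symA.
have [w wa w1] : exists2 w : 'rV[R]_n.+1, w *m A = a *: w & w *m w^T = 1%:M.
  have s0 := sum_sqr_row_gt0 v0; set s := \sum_i _ in s0.
  exists ((Num.sqrt s)^-1 *: v); first by rewrite -scalemxAl va !scalerA mulrC.
  rewrite linearZ/= -scalemxAl -scalemxAr scalerA mul_tr_row -/s scale_scalar_mx.
  by rewrite -expr2 exprVn sqr_sqrtr ?ltW// mulVf// gt_eqF.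
have [H [symH HH eH]] := householder w1.
pose B : 'M[R]_(1 + n) := H *m A *m H.
have symB : B^T = B by rewrite /B !trmx_mul symH symA mulmxA.
have eB : delta_mx 0 0 *m B = a *: (delta_mx 0 0 : 'rV_n.+1).
  by rewrite /B !mulmxA eH wa -scalemxAl -eH -mulmxA HH mulmx1.
have BH : B *m H = H *m A by rewrite -mulmxA HH mulmx1.
clearbody B.
have B0 j : B 0 j = a * (j == 0)%:R.
  have := congr1 (fun M : 'rV_n.+1 => M 0 j) eB.
  by rewrite -rowE !mxE eqxx.
have lsh0 (i : 'I_1) : lshift n i = 0 by rewrite (ord1 i); apply/val_inj.
have rsh0 (i : 'I_n) : (rshift 1 i == 0) = false by [].
have ulB : ulsubmx B = a%:M.
  by apply/matrixP => i j; rewrite !mxE !ord1 !lsh0 B0 eqxx mulr1.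
have urB : ursubmx B = 0.
  by apply/matrixP => i j; rewrite !mxE lsh0 B0 rsh0 mulr0.
have dlB : dlsubmx B = 0 by rewrite -symB -trmx_ursub urB trmx0.
have BE : B = block_mx a%:M 0 0 (drsubmx B).
  by rewrite -[LHS](@submxK _ 1 n 1 n) ulB urB dlB.
have [|O [d OO OB]] := IHn (drsubmx B); first by rewrite trmx_drsub symB.
pose O1 : 'M[R]_(1 + n) := block_mx 1%:M 0 0 O.
have O1O1 : O1 *m O1^T = 1%:M.
  rewrite /O1 tr_block_mx mulmx_block !trmx0 !mul0mx !mulmx0 trmx1 mulmx1 OO.
  by rewrite !addr0 !add0r -scalar_mx_block.
have O1B : O1 *m B = diag_mx (row_mx a%:M d : 'rV_(1 + n)) *m O1.
  rewrite BE diag_mx_row /O1 !mulmx_block.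
  rewrite !mul0mx !mulmx0 !addr0 !add0r OB mulmx1 mul1mx.
  by congr (block_mx _ _ _ _); apply/matrixP => i j; rewrite !ord1 !mxE.
clearbody O1; exists ((O1 : 'M[R]_n.+1) *m H), (row_mx a%:M d : 'rV_(1 + n)).
  by rewrite trmx_mul mulmxA -(mulmxA _ H) symH HH mulmx1.
by rewrite -mulmxA -BH !mulmxA; congr (_ *m H).
Qed.
End RealSpectral.

(** * Reversible kernels *)

Section Kernels.
Variables (R : realType) (X : finType).
Implicit Types (P : X -> X -> R) (pi : X -> R) (f g : X -> R).

Definition laplacian P f x : R := f x - \sum_y P x y * f y.

Lemma laplacian_sym P pi f g : reversible P pi ->
  \sum_x pi x * f x * laplacian P g x = \sum_x pi x * g x * laplacian P f x.
Proof.
move=> rev; under eq_bigr do rewrite mulrBr; under [RHS]eq_bigr do rewrite mulrBr.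
rewrite !sumrB; congr (_ - _); first by apply: eq_bigr => x _; ring.
under eq_bigr do rewrite mulr_sumr; under [RHS]eq_bigr do rewrite mulr_sumr.
rewrite exchange_big; apply: eq_bigr => y _; apply: eq_bigr => x _.
rewrite mulrACA [RHS]mulrACA.
transitivity (pi x * P x y * (f x * g y)); first ring.
by rewrite rev; ring.
Qed.

(** Expand the square: detailed balance makes the two square terms equal, and the unit row sums
    collapse them to the squared norm. *)
Lemma dirichletE P pi f : markov_kernel P -> reversible P pi ->
  dirichlet P pi f = \sum_x pi x * f x * laplacian P f x.
Proof.
move=> [_ P1] rev; rewrite /dirichlet.
pose a := \sum_x \sum_y f x ^+ 2 * P x y * pi x.
pose b := \sum_x \sum_y f x * f y * P x y * pi x.
have -> : \sum_x \sum_y `|f x - f y| ^+ 2 * P x y * pi x = a + a - 2 * b.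
  have {2}-> : a = \sum_x \sum_y f y ^+ 2 * P x y * pi x.
    rewrite /a exchange_big; apply: eq_bigr => y _; apply: eq_bigr => x _.
    by rewrite -!mulrA ![P _ _ * _]mulrC rev.
  rewrite mulr_sumr -!big_split/= -sumrB; apply: eq_bigr => x _.
  rewrite mulr_sumr -!big_split/= -sumrB; apply: eq_bigr => y _.
  by rewrite real_normK ?num_real//; ring.
have -> : 2^-1 * (a + a - 2 * b) = a - b by field.
rewrite /a /b -sumrB; apply: eq_bigr => x _.
rewrite mulrBr; congr (_ - _).
  by rewrite -mulr_suml -mulr_sumr P1; ring.
by rewrite mulr_sumr; apply: eq_bigr => y _; ring.
Qed.

Lemma dirichletD P pi f g : markov_kernel P -> reversible P pi ->
  dirichlet P pi (fun x => f x + g x) =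
  dirichlet P pi f + dirichlet P pi g + 2 * \sum_x pi x * g x * laplacian P f x.
Proof.
move=> mP rev; rewrite !dirichletE//.
rewrite mulr2n mulrDl mul1r {1}(laplacian_sym g f rev) -!big_split/=.
apply: eq_bigr => x _.
have -> : laplacian P (fun y => f y + g y) x = laplacian P f x + laplacian P g x.
  rewrite /laplacian; under eq_bigr do rewrite mulrDr.
  by rewrite big_split/=; ring.
ring.
Qed.

Lemma dirichlet_ge0 P pi f : markov_kernel P -> (forall x, 0 <= pi x) ->
  0 <= dirichlet P pi f.
Proof.
move=> [P0 _] pi0; rewrite mulr_ge0// sumr_ge0// => x _; rewrite sumr_ge0// => y _.
by rewrite !mulr_ge0 ?exprn_ge0.
Qed.

Lemma norm2sq_gt0 pi f x : (forall x, 0 < pi x) -> f x != 0 -> 0 < norm2sq pi f.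
Proof.
move=> pi0 fx; rewrite /norm2sq (bigD1 x)//= ltr_wpDr//.
  by rewrite sumr_ge0// => y _; rewrite mulr_ge0 ?exprn_ge0// ltW.
by rewrite mulr_gt0 ?exprn_gt0 ?normr_gt0.
Qed.

Lemma kernel_iter0 P x y : kernel_iter P 0 x y = (x == y)%:R.
Proof. by rewrite /kernel_iter expr0 mxE (inj_eq enum_rank_inj). Qed.

Lemma kernel_iterS P n x y :
  kernel_iter P n.+1 x y = \sum_z P x z * kernel_iter P n z y.
Proof.
rewrite /kernel_iter exprS mxE (reindex _ (onW_bij _ (@enum_rank_bij X))).
by apply: eq_bigr => z _; rewrite mxE !enum_rankK.
Qed.

Lemma kernel_iter_ge0 P n x y : markov_kernel P -> 0 <= kernel_iter P n x y.
Proof.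
move=> [P0 _]; elim: n x => [|n IHn] x; first by rewrite kernel_iter0 ler0n.
by rewrite kernel_iterS sumr_ge0// => z _; rewrite mulr_ge0.
Qed.

Lemma stationary_iter P pi n y : stationary_distribution P pi ->
  \sum_x pi x * kernel_iter P n x y = pi y.
Proof.
move=> [_ _ st]; elim: n => [|n IHn].
  rewrite (bigD1 y)//= kernel_iter0 eqxx mulr1 big1 ?addr0// => x /negbTE xy.
  by rewrite kernel_iter0 xy mulr0.
under eq_bigr do rewrite kernel_iterS mulr_sumr.
rewrite exchange_big -[RHS]IHn/=; apply: eq_bigr => z _.
by rewrite -[in RHS]st mulr_suml; apply: eq_bigr => x _; rewrite mulrA.
Qed.

(** Some state carries mass, since the total is 1; irreducibility transports part of it to [y], and
    stationarity keeps it there. *)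
Lemma stationary_gt0 P pi : markov_kernel P -> irreducible P ->
  stationary_distribution P pi -> forall y, 0 < pi y.
Proof.
move=> mP irr st y; have [pi0 pi1 _] := st.
have [x pix] : exists x, 0 < pi x.
  apply/existsP; apply: contraTT (@oner_neq0 R) => /existsPn pi_le0.
  rewrite negbK -pi1 big1// => x _; apply/eqP.
  by rewrite eq_le pi0 leNgt pi_le0.
have [n Pn] := irr x y; rewrite -(stationary_iter n y st) (bigD1 x)//= ltr_pwDl//.
  by rewrite mulr_gt0.
by rewrite sumr_ge0// => z _; rewrite mulr_ge0// kernel_iter_ge0.
Qed.

(** Zero energy forces equal values across every edge of positive probability, and irreducibility
    chains such edges. *)
Lemma dirichlet0_const P pi f : markov_kernel P -> irreducible P ->
  (forall x, 0 < pi x) -> dirichlet P pi f = 0 -> forall x y, f x = f y.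
Proof.
move=> mP irr pi0 f0; have [P0 _] := mP.
have step x y : 0 < P x y -> f x = f y.
  move=> Pxy; apply/eqP; rewrite -subr_eq0; apply: contra_eqT f0 => fxy.
  rewrite gt_eqF// mulr_gt0// (bigD1 x)//= ltr_pwDl//; last first.
    rewrite sumr_ge0// => z _; rewrite sumr_ge0// => t _.
    by rewrite !mulr_ge0 ?exprn_ge0// ltW.
  rewrite (bigD1 y)//= ltr_pwDl//; last first.
    by rewrite sumr_ge0// => t _; rewrite !mulr_ge0 ?exprn_ge0// ltW.
  by rewrite !mulr_gt0 ?exprn_gt0 ?normr_gt0.
move=> x y; have [n] := irr x y; elim: n x => [|n IHn] x.
  by rewrite kernel_iter0; have [->//|] := eqVneq x y; rewrite ltxx.
rewrite kernel_iterS => /gt_eqF/negbT.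
have [z /andP[xz zy] _|none] := pickP (fun z => (0 < P x z) && (0 < kernel_iter P n z y)).
  by rewrite (step _ _ xz) (IHn _ zy).
rewrite big1 ?eqxx// => z _; apply/eqP.
have := none z; rewrite !lt_def P0 kernel_iter_ge0// !andbT => /negbT.
by rewrite negb_and !negbK mulf_eq0.
Qed.

(** For each [x], its number of occurrences on either side is its multiplicity as a root of the
    characteristic polynomial. *)
Lemma perm_eigenvalues P (s : seq R) :
  char_poly (kernel_mx P) = \prod_(a <- s) ('X - a%:P) ->
  perm_eq (eigenvalues P) s.
Proof.
move=> pE; rewrite /eigenvalues; set p := char_poly _ in pE *.
rewrite perm_sort; apply/allP => x _ /=; apply/eqP.
rewrite -[RHS]mu_prod_XsubC -pE count_flatten -map_comp sumnE big_map.
have p0 : p != 0 by rewrite monic_neq0// char_poly_monic.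
transitivity (\sum_(a <- rootsR p | a == x) mup a p)%N.
  rewrite [RHS]big_mkcond; apply: eq_bigr => a _ /=.
  by rewrite count_nseq /=; case: eqP => _; rewrite ?mul1n ?mul0n.
have [xr|xr] := boolP (x \in rootsR p).
  by rewrite -big_filter filter_pred1_uniq ?uniq_roots// big_seq1.
rewrite big_seq_cond big1 => [|a /andP[ar /eqP ax]]; last by rewrite -ax ar in xr.
rewrite mupNroot//; apply: contra xr => xr.
by have /(_ x) := roots_on_rootsR p0; rewrite !inE xr /= => <-.
Qed.

Lemma le_beta P i j : (i <= j < size (eigenvalues P))%N -> beta P j <= beta P i.
Proof.
case/andP => ij jn; rewrite /beta /eigenvalues.
have tr : transitive (fun a b : R => b <= a) by move=> a b c ab /le_trans; apply.
apply: (sorted_leq_nth tr) => //.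
- by apply: sort_sorted => a b; exact: le_total.
- by rewrite inE (leq_ltn_trans ij).
Qed.

(** By reversibility, conjugating by [diag (sqrt pi)] makes the kernel symmetric. Each [phi j] is
    [pi] times a normalized eigenfunction, so the plain sum of [f x * phi j x] is already the
    coefficient of [f] in the weighted inner product. *)
Lemma spectral_decomposition P pi : markov_kernel P -> reversible P pi ->
  (forall x, 0 < pi x) -> size (eigenvalues P) = #|X| /\
  exists phi : 'I_#|X| -> X -> R, forall f,
    norm2sq pi f = \sum_(j < #|X|) (\sum_x f x * phi j x) ^+ 2 /\
    dirichlet P pi f = \sum_(j < #|X|) (1 - beta P j) * (\sum_x f x * phi j x) ^+ 2.
Proof.
move=> mP rev pi0; pose r (i : 'I_#|X|) := Num.sqrt (pi (enum_val i)) : R.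
have r0 i : r i != 0 by rewrite gt_eqF// /r sqrtr_gt0.
have rr i : r i * r i = pi (enum_val i) by rewrite -expr2 sqr_sqrtr// ltW.
pose S := diag_mx (\row_i r i).
pose A := \matrix_(i < #|X|, j < #|X|) (r i * P (enum_val i) (enum_val j) / r j).
have symA : A^T = A.
  apply/matrixP => i j; rewrite !mxE.
  apply: (mulIf (r0 i)); apply: (mulIf (r0 j)).
  rewrite divfK// [RHS]mulrAC divfK//.
  transitivity (r j * r j * P (enum_val j) (enum_val i)); first ring.
  by rewrite rr rev -rr; ring.
have [U [d UU UA]] := symmetric_spectral symA.
have [UtU uU] : U^T *m U = 1%:M /\ U \in unitmx.
  by split; [exact: mulmx1C | case: (mulmx1_unit UU)].
have Su : S \in unitmx.
  by rewrite unitmxE det_diag unitfE; apply/prodf_neq0 => i _; rewrite mxE.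
have SA : S *m kernel_mx P = A *m S.
  by apply/matrixP => i j; rewrite mul_diag_mx mul_mx_diag !mxE divfK.
have := perm_eigenvalues (etrans (char_poly_conj Su SA)
  (etrans (char_poly_conj uU UA) (char_poly_diag d))).
set t := [seq d 0 i | i : 'I_#|X|] => pt; split.
  by rewrite (perm_size pt) size_map size_enum_ord.
(* The diagonalization returns the eigenvalues unordered; [p] matches them with the sorted list
   behind [beta]. *)
have [p pE] : exists p : {perm 'I_#|X|}, forall j : 'I_#|X|, beta P j = d 0 (p j).
  have tsz : size t == #|X| by rewrite size_map size_enum_ord.
  have /tuple_permP [p pE] : perm_eq (eigenvalues P) (Tuple tsz) by [].
  exists p => j; rewrite /beta pE -tnth_nth tnth_mktuple (tnth_nth 0) /=.
  by rewrite (nth_map j) ?size_enum_ord// nth_ord_enum.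
exists (fun j x => U (p j) (enum_rank x) * r (enum_rank x)) => f.
pose g := \row_i (f (enum_val i) * r i).
pose c := g *m U^T.
have cE j : \sum_x f x * (U (p j) (enum_rank x) * r (enum_rank x)) = c 0 (p j).
  rewrite /c mxE [RHS](reindex _ (onW_bij _ (@enum_rank_bij X))).
  by apply: eq_bigr => x _; rewrite !mxE enum_rankK; ring.
have scal (a b : R) : a%:M = b%:M :> 'M[R]_1 -> a = b.
  by move/matrixP => /(_ 0 0); rewrite !mxE.
have nE : norm2sq pi f = \sum_j c 0 j ^+ 2.
  apply: scal; rewrite -mul_tr_row /c trmx_mul trmxK mulmxA -(mulmxA g) UtU mulmx1.
  rewrite mul_tr_row; congr _%:M; rewrite /norm2sq.
  rewrite (reindex _ (onW_bij _ (@enum_val_bij X))); apply: eq_bigr => i _.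
  by rewrite mxE exprMn real_normK ?num_real// [r i ^+ 2]expr2 rr.
(* In the coordinates [g = f * sqrt pi], the form of [P] weighted by [pi] is that of the symmetric
   matrix [A]. *)
have qE : \sum_x \sum_y pi x * f x * (P x y * f y) = \sum_j d 0 j * c 0 j ^+ 2.
  have AE : A = U^T *m diag_mx d *m U by rewrite -mulmxA -UA mulmxA UtU mul1mx.
  transitivity ((g *m A *m g^T) 0 0); last first.
    rewrite AE !mulmxA -/c -mulmxA -[U *m _]trmxK trmx_mul trmxK -/c mxE.
    by apply: eq_bigr => j _; rewrite mul_mx_diag !mxE; ring.
  rewrite mxE exchange_big (reindex _ (onW_bij _ (@enum_val_bij X))).
  apply: eq_bigr => j _; rewrite !mxE mulr_suml.
  rewrite (reindex _ (onW_bij _ (@enum_val_bij X))); apply: eq_bigr => i _.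
  by rewrite !mxE -rr; field.
split; first by rewrite nE (reindex_perm p); apply: eq_bigr => j _; rewrite cE.
transitivity (norm2sq pi f - \sum_x \sum_y pi x * f x * (P x y * f y)).
  rewrite dirichletE// /norm2sq -sumrB; apply: eq_bigr => x _.
  rewrite /laplacian mulrBr mulr_sumr real_normK ?num_real//.
  by congr (_ - _); ring.
rewrite nE qE -sumrB (reindex_perm p); apply: eq_bigr => j _.
by rewrite cE pE; ring.
Qed.

End Kernels.

(** * Eigenvalue counting and entropy *)

(** Fewer linear conditions than unknowns: the rank is at most [#|I|], so the left kernel is
    nonzero. *)
Lemma ex_common_kernel (F : fieldType) (X I : finType) (G : I -> X -> F) :
  (#|I| < #|X|)%N ->
  exists h : X -> F, (exists x, h x != 0) /\ forall i, \sum_x h x * G i x = 0.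
Proof.
move=> IX; pose A := \matrix_(i < #|X|, j < #|I|) G (enum_val j) (enum_val i).
have : kermx A != 0.
  by rewrite -mxrank_eq0 mxrank_ker -lt0n subn_gt0 (leq_ltn_trans (rank_leq_col A)).
case/rowV0Pn => v /sub_kermxP vA v0; exists (fun x => v 0 (enum_rank x)); split.
  have [i vi] : exists i, v 0 i != 0.
    apply/existsP; apply: contraR v0 => /existsPn v0; apply/eqP/rowP => i.
    by rewrite mxE; apply/eqP; have := v0 i; rewrite negbK.
  by exists (enum_val i); rewrite enum_valK.
move=> i; have /matrixP/(_ 0 (enum_rank i)) := vA; rewrite !mxE => {2}<-.
rewrite [RHS](reindex _ (onW_bij _ (@enum_rank_bij X))).
by apply: eq_bigr => x _; rewrite !mxE !enum_rankK.
Qed.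

Section Beta.
Variables (R : realType) (X : finType) (P : X -> X -> R) (pi : X -> R).
Hypotheses (mP : markov_kernel P) (rev : reversible P pi).
Hypothesis pi_gt0 : forall x, 0 < pi x.

Lemma beta_le1 (j : 'I_#|X|) : beta P j <= 1.
Proof.
have [sz [phi phiE]] := spectral_decomposition mP rev pi_gt0.
(* Killing all coefficients except the [j]-th isolates one eigenvalue: the energy of [h] is then
   [1 - beta P j] times its squared norm. *)
have [|h [[x hx] h0]] :=
    @ex_common_kernel R X {k : 'I_#|X| | k != j} (fun k => phi (val k)).
  have := cardC1 j; rewrite card_ord card_sig => ->.
  by rewrite ltn_predL (leq_ltn_trans _ (ltn_ord j)).
have [nE dE] := phiE h.
have c0 k : k != j -> \sum_x h x * phi k x = 0 by move=> kj; exact: (h0 (Sub k kj)).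
have {}nE : norm2sq pi h = (\sum_x h x * phi j x) ^+ 2.
  by rewrite nE (bigD1 j)//= [X in _ + X]big1 ?addr0// => k kj; rewrite c0// expr0n.
have {}dE : dirichlet P pi h = (1 - beta P j) * (\sum_x h x * phi j x) ^+ 2.
  by rewrite dE (bigD1 j)//= [X in _ + X]big1 ?addr0// => k kj; rewrite c0// expr0n mulr0.
rewrite -subr_ge0 -(pmulr_lge0 _ (norm2sq_gt0 pi_gt0 hx)) nE -dE.
by apply: dirichlet_ge0 => // y; exact: ltW.
Qed.

(** Constants have zero energy. If the largest eigenvalue were below 1, every weight [1 - beta P j]
    would be positive, forcing all coefficients of the constant 1 to vanish. *)
Lemma beta0 : (0 < #|X|)%N -> beta P 0 = 1.
Proof.
move=> X0; apply/eqP; rewrite eq_le (beta_le1 (Ordinal X0))/=.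
have [sz [phi phiE]] := spectral_decomposition mP rev pi_gt0.
have [nE dE] := phiE (fun=> 1); rewrite leNgt; apply/negP => b0.
have : 0 < norm2sq pi (fun=> 1).
  by apply: (@norm2sq_gt0 _ _ _ _ (enum_val (Ordinal X0))); rewrite ?oner_neq0.
have : dirichlet P pi (fun=> 1) = 0.
  rewrite /dirichlet big1 ?mulr0// => x _; rewrite big1// => y _.
  by rewrite subrr normr0 expr0n !mul0r.
rewrite nE dE => d0; rewrite lt_neqAle => /andP[/eqP[]]; apply/esym.
have b1 (j : 'I_#|X|) : 0 < 1 - beta P j.
  by rewrite subr_gt0 (le_lt_trans _ b0)// le_beta// sz ltn_ord.
rewrite big1// => j _; move/eqP: d0; rewrite psumr_eq0 => [/allP/(_ j)|k _].
  rewrite mem_index_enum => /(_ isT) /=.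
  by rewrite mulf_eq0 gt_eqF//= => /eqP.
by rewrite mulr_ge0 ?sqr_ge0// ltW.
Qed.

(** Expanding the energy of [h + (g - h)], the cross term vanishes pointwise: on [D] by harmonicity
    of [h], off [D] because [g - h] is zero. *)
Lemma harmonic_min (D : {pred X}) h g : {in D, laplacian P h =1 fun=> 0} ->
  {in [predC D], h =1 g} -> dirichlet P pi h <= dirichlet P pi g.
Proof.
move=> h0 hg; have -> : g = fun x => h x + (g x - h x).
  by apply/funext => x; rewrite addrC subrK.
rewrite dirichletD// [X in 2 * X]big1 => [|x _].
  by rewrite mulr0 addr0 lerDl dirichlet_ge0// => x; exact: ltW.
have [xD|xD] := boolP (x \in D); first by rewrite h0// mulr0.
by rewrite hg ?inE// subrr mulr0 mul0r.
Qed.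

End Beta.

Section Entropy.
Variable R : realType.

(** This is [ln t <= t - 1] at [t = c / a], multiplied by [a]. *)
Lemma entropy_term_ge0 (a c : R) : 0 <= a -> 0 < c -> 0 <= a * ln (a / c) - a + c.
Proof.
move=> a0 c0; have [->|an0] := eqVneq a 0.
  by rewrite mul0r subr0 add0r ltW.
have {a0} a0 : 0 < a by rewrite lt_def an0.
have -> : ln (a / c) = - ln (c / a).
  by rewrite -[in LHS](invrK (a / c)) invf_div lnV// posrE divr_gt0.
have : ln (c / a) <= c / a - 1.
  have := @le_ln1Dx R (c / a - 1); rewrite [1 + _]addrC subrK; apply.
  by rewrite ltrBrDl subrr divr_gt0.
move=> /(ler_wpM2l (ltW a0)); rewrite mulrBr mulr1 mulrCA divff// mulr1 mulrN.
by lra.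
Qed.

Variables (X : finType) (pi : X -> R).
Hypotheses (pi_ge0 : forall x, 0 <= pi x) (pi_sum : \sum_x pi x = 1).

(** Unlike the integrand of [entropy2], this one is pointwise nonnegative for [c > 0], so its
    integrals can be compared when one measure dominates another. *)
Definition entropy_at f c : R :=
  \sum_x (f x ^+ 2 * ln (f x ^+ 2 / c) - f x ^+ 2 + c) * pi x.

Lemma entropy_at_ge0 f c : 0 < c -> 0 <= entropy_at f c.
Proof.
by move=> c0; apply: sumr_ge0 => x _; rewrite mulr_ge0// entropy_term_ge0// sqr_ge0.
Qed.

(* The correction term is itself nonnegative and vanishes at [c = norm2sq pi f], so
   that [entropy2 pi f] is the minimum of [entropy_at f c] over [c > 0]. *)
Lemma entropy2_variational f c : 0 < norm2sq pi f -> 0 < c ->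
  entropy2 pi f = entropy_at f c -
    (norm2sq pi f * ln (norm2sq pi f / c) - norm2sq pi f + c).
Proof.
move=> n0 c0; set n := norm2sq pi f in n0 *.
have nE : n = \sum_x f x ^+ 2 * pi x.
  by apply: eq_bigr => x _; rewrite real_normK ?num_real.
have -> : n * ln (n / c) - n + c =
    \sum_x (f x ^+ 2 * ln (n / c) - f x ^+ 2 + c) * pi x.
  under eq_bigr do rewrite mulrDl mulrBl mulrAC.
  by rewrite big_split/= sumrB -mulr_suml -nE -mulr_sumr pi_sum mulr1.
rewrite -sumrB; apply: eq_bigr => x _; rewrite real_normK ?num_real// -/n.
have [->|fx] := eqVneq (f x) 0; first by rewrite expr0n/=; ring.
have f0 : 0 < f x ^+ 2 by rewrite exprn_even_gt0.
rewrite !ln_div ?posrE//; ring.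
Qed.

Lemma entropy2_le_at f c : 0 < norm2sq pi f -> 0 < c ->
  entropy2 pi f <= entropy_at f c.
Proof.
move=> n0 c0; rewrite (entropy2_variational n0 c0) gerBl.
by rewrite entropy_term_ge0// ltW.
Qed.

Lemma entropy2E f : 0 < norm2sq pi f -> entropy2 pi f = entropy_at f (norm2sq pi f).
Proof.
move=> n0; rewrite (entropy2_variational n0 n0).
by rewrite divff ?gt_eqF// ln1 mulr0 sub0r addNr subr0.
Qed.

Lemma entropy2_const (a : R) : entropy2 pi (fun=> a) = 0.
Proof.
rewrite /entropy2 /norm2sq -!mulr_sumr pi_sum !mulr1 real_normK ?num_real//.
have [->|a0] := eqVneq a 0; first by rewrite expr0n/= mul0r.
by rewrite divff ?expf_neq0// ln1 mulr0.
Qed.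

End Entropy.

(** * Comparison of the two kernels *)

Lemma card_ord_lt n m : (m <= n)%N -> #|{: {j : 'I_n | (j < m)%N}}| = m.
Proof.
by move=> mn; rewrite card_sig -sum1_card (big_ord_narrow mn) big_const_ord
  iter_addn_0 mul1n.
Qed.

Lemma card_ord_gt n m : (m < n)%N -> (m.+1 + #|{: {j : 'I_n | (m < j)%N}}|)%N = n.
Proof.
move=> mn; have gtC : [predC [pred j : 'I_n | (j < m.+1)%N]] =i [pred j : 'I_n | (m < j)%N].
  by move=> j; rewrite !inE -leqNgt.
rewrite card_sig -(fintype.eq_card gtC).
by rewrite -[X in (X + _)%N](card_ord_lt mn) card_sig cardC card_ord.
Qed.

Section Comparison.
Variables (R : realType) (hOmega : finType) (Omega : {set hOmega}).
Local Notation S := {x : hOmega | x \in Omega}.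
Variables (K : hOmega -> hOmega -> R) (mu : hOmega -> R).
Variables (Q : S -> S -> R) (nu : S -> R).
Hypotheses (mK : markov_kernel K) (revK : reversible K mu).
Hypothesis mu_gt0 : forall x, 0 < mu x.
Hypotheses (mQ : markov_kernel Q) (revQ : reversible Q nu).
Hypothesis nu_gt0 : forall x, 0 < nu x.
Variables C1 C3 : R.
Hypothesis nu_le : forall y : S, nu y <= C1 * mu (val y).

Lemma sum_restrict (F : hOmega -> R) :
  \sum_(y : S) F (val y) = \sum_(x in Omega) F x.
Proof. exact/esym/big_sub. Qed.

(** Domination of [nu] by [C1 * mu] gives the bound on [Omega]; points outside only add nonnegative
    terms. *)
Lemma sum_nu_le (G : S -> R) (F : hOmega -> R) : 0 <= C1 ->
  (forall x, 0 <= F x) -> (forall y, G y = F (val y)) ->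
  \sum_y G y * nu y <= C1 * \sum_x F x * mu x.
Proof.
move=> C1_ge0 F0 GF; apply: (@le_trans _ _ (C1 * \sum_(x in Omega) F x * mu x)).
  rewrite -(sum_restrict (fun x => F x * mu x)) mulr_sumr ler_sum// => y _.
  by rewrite GF mulrCA ler_wpM2l.
rewrite ler_wpM2l// [leRHS](bigID [in Omega])/= lerDl sumr_ge0// => x _.
by rewrite mulr_ge0// ltW.
Qed.

Lemma beta_comparison i : (i < #|Omega|)%N -> 0 <= C1 -> 0 <= C3 ->
  (forall h, {in [predC Omega], laplacian K h =1 fun=> 0} ->
    dirichlet K mu h <= C3 * dirichlet Q nu (fun y => h (val y))) ->
  1 - beta K i <= C1 * C3 * (1 - beta Q i).
Proof.
move=> iO C1_ge0 C3_ge0 hC3.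
have cardS : #|{: S}| = #|Omega| by rewrite card_sig; apply: fintype.eq_card => x; rewrite inE.
have iS : (i < #|{: S}|)%N by rewrite cardS.
have iX : (i < #|hOmega|)%N by rewrite (leq_trans iO)// max_card.
have [szK [phi phiE]] := spectral_decomposition mK revK mu_gt0.
have [szQ [psi psiE]] := spectral_decomposition mQ revQ nu_gt0.
(* Extension by zero turns a linear condition on the restriction of [h] to [Omega] into one on [h]
   itself. *)
pose ext (g : S -> R) x := if insub x is Some y then g y else 0.
have extE h g : \sum_(y : S) h (val y) * g y = \sum_x h x * ext g x.
  rewrite [RHS](bigID [in Omega])/= [X in _ + X]big1 ?addr0 => [|x xO].
    rewrite -(sum_restrict (fun x => h x * ext g x)).
    by apply: eq_bigr => y _; rewrite /ext valK.
  by rewrite /ext insubN// mulr0.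
pose lap x z : R := (z == x)%:R - K x z.
have lapE h x : laplacian K h x = \sum_z h z * lap x z.
  rewrite /laplacian /lap; under [RHS]eq_bigr do rewrite mulrBr.
  rewrite sumrB [X in _ = X - _](bigD1 x)//= eqxx mulr1.
  rewrite [X in _ = _ + X - _]big1 => [|z /negbTE->]; last by rewrite mulr0.
  by rewrite addr0; congr (_ - _); apply: eq_bigr => z _; rewrite mulrC.
pose I := ({x | x \notin Omega} + ({j : 'I_#|hOmega| | (j < i)%N}
           + {k : 'I_#|{: S}| | (i < k)%N}))%type.
pose G (t : I) : hOmega -> R := match t with
  | inl x => lap (val x) | inr (inl j) => phi (val j)
  | inr (inr k) => ext (psi (val k)) end.
have [|h [[x0 hx0] hG]] := @ex_common_kernel R hOmega I G.
  have notinC : [pred x : hOmega | x \notin Omega] =i [predC Omega].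
    by move=> x; rewrite !inE.
  rewrite !card_sum (card_ord_lt (ltnW iX)).
  rewrite [#|{: {x | x \notin Omega}}|]card_sig (fintype.eq_card notinC).
  rewrite -(cardC Omega) addnC ltn_add2r.
  (* Off [Omega] the counts cancel; what remains is [i + (#|Omega| - 1 - i)], one less than
     [#|Omega|]. *)
  exact: eq_leq (etrans (card_ord_gt iS) cardS).
have h_lap : {in [predC Omega], laplacian K h =1 fun=> 0}.
  by move=> x xO; rewrite lapE (hG (inl (Sub x xO))).
have h_phi (j : 'I_#|hOmega|) : (j < i)%N -> \sum_x h x * phi j x = 0.
  by move=> ji; exact: (hG (inr (inl (Sub j ji)))).
have h_psi (k : 'I_#|{: S}|) : (i < k)%N -> \sum_(y : S) h (val y) * psi k y = 0.
  by move=> ik; rewrite extE; exact: (hG (inr (inr (Sub k ik)))).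
pose f (y : S) := h (val y).
have nh0 : 0 < norm2sq mu h by exact: norm2sq_gt0 hx0.
have lowK : (1 - beta K i) * norm2sq mu h <= dirichlet K mu h.
  have [-> ->] := phiE h; rewrite mulr_sumr ler_sum// => j _.
  have [ji|ij] := ltnP j i; first by rewrite h_phi// expr0n !mulr0.
  by rewrite ler_wpM2r ?sqr_ge0// lerD2l lerN2 le_beta// ij szK ltn_ord.
have upQ : dirichlet Q nu f <= (1 - beta Q i) * norm2sq nu f.
  have [-> ->] := psiE f; rewrite mulr_sumr ler_sum// => k _.
  have [ik|ki] := ltnP i k; first by rewrite h_psi// expr0n !mulr0.
  by rewrite ler_wpM2r ?sqr_ge0// lerD2l lerN2 le_beta// ki szQ.
have nf : norm2sq nu f <= C1 * norm2sq mu h.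
  by apply: sum_nu_le => // x; rewrite exprn_ge0.
rewrite -(ler_pM2r nh0) (le_trans lowK)// (le_trans (hC3 h h_lap))//.
apply: (le_trans (ler_wpM2l C3_ge0 upQ)).
rewrite [leRHS](_ : _ = C3 * ((1 - beta Q i) * (C1 * norm2sq mu h))); last ring.
(* Replacing the norm of [f] by [C1] times that of [h] is legitimate only for a nonnegative factor,
   hence [beta Q i <= 1]. *)
rewrite ler_wpM2l// ler_wpM2l// subr_ge0.
by apply: (beta_le1 mQ revQ nu_gt0 (Ordinal iS)).
Qed.

Lemma entropy2_comparison f g : 0 <= C1 -> \sum_x mu x = 1 -> \sum_y nu y = 1 ->
  (forall y, g (val y) = f y) -> entropy2 nu f != 0 ->
  0 < entropy2 nu f <= C1 * entropy2 mu g.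
Proof.
move=> C1_ge0 mu1 nu1 gf Lf.
have [y fy] : exists y, f y != 0.
  apply/existsP; apply: contraR Lf => /existsPn f0.
  rewrite /entropy2 big1// => y _; have /negPn/eqP -> := f0 y.
  by rewrite normr0 expr0n/= !mul0r.
have nf : 0 < norm2sq nu f by exact: norm2sq_gt0 fy.
have ng : 0 < norm2sq mu g by apply: (@norm2sq_gt0 _ _ _ _ (val y)); rewrite ?gf.
have mu0 x : 0 <= mu x by exact: ltW.
have nu0 x : 0 <= nu x by exact: ltW.
rewrite lt_def Lf [X in 0 <= X]entropy2E// entropy_at_ge0//=.
apply: (le_trans (entropy2_le_at nu1 nf ng)); rewrite [entropy2 mu g]entropy2E//.
apply: sum_nu_le => // x; first by rewrite entropy_term_ge0// sqr_ge0.
by rewrite gf.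
Qed.

End Comparison.

Theorem mainTheorem8 (R : realType) (hOmega : finType) (Omega : {set hOmega})
  (K : hOmega -> hOmega -> R) (mu : hOmega -> R)
  (Q : {x : hOmega | x \in Omega} -> {x : hOmega | x \in Omega} -> R)
  (nu : {x : hOmega | x \in Omega} -> R)
  (M : ({x : hOmega | x \in Omega} -> R) -> (hOmega -> R))
  (C1 C3 : R)
  (K_kernel : markov_kernel K) (K_lazy : lazy K)
  (K_irreducible : irreducible K) (mu_stationary : stationary_distribution K mu)
  (K_ergodic : ergodic K mu) (K_reversible : reversible K mu)
  (Q_kernel : markov_kernel Q) (Q_lazy : lazy Q)
  (Q_irreducible : irreducible Q) (nu_stationary : stationary_distribution Q nu)
  (Q_ergodic : ergodic Q nu) (Q_reversible : reversible Q nu)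
  (M_extension : forall (f : {x : hOmega | x \in Omega} -> R)
     (x : {x : hOmega | x \in Omega}), M f (val x) = f x)
  (C3_bound : forall f : {x : hOmega | x \in Omega} -> R,
     dirichlet K mu (M f) <= C3 * dirichlet Q nu f)
  (C1_def : C1 = sup (range (fun y : {x : hOmega | x \in Omega} =>
                              nu y / mu (val y)))) :
  (forall i : nat, (i <= #|Omega| - 1)%N ->
     (C1 * C3)^-1 * (1 - beta K i) <= 1 - beta Q i) /\
  ((C1 * C3)^-1%:E * log_sobolev K mu <= log_sobolev Q nu)%E.
Proof.
have mu_gt0 := stationary_gt0 K_kernel K_irreducible mu_stationary.
have nu_gt0 := stationary_gt0 Q_kernel Q_irreducible nu_stationary.
have [mu_ge0 mu1 _] := mu_stationary; have [nu_ge0 nu1 _] := nu_stationary.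
have C1_ub y : nu y / mu (val y) <= C1.
  rewrite C1_def; apply: ub_le_sup; last by exists y.
  (* A real supremum is an upper bound only for a bounded set; the sum of all the ratios bounds each
     of them. *)
  exists (\sum_z nu z / mu (val z)) => _ [z _ <-].
  by rewrite (bigD1 z)//= lerDl sumr_ge0// => t _; rewrite divr_ge0.
have nu_le y : nu y <= C1 * mu (val y) by rewrite -ler_pdivrMr.
have [y0] : exists y0 : {x : hOmega | x \in Omega}, true.
  apply/existsP; apply: contraTT (@oner_neq0 R) => /existsPn no.
  by rewrite negbK -nu1 big1// => y; have := no y.
move=> _; have C1_gt0 : 0 < C1 by rewrite (lt_le_trans _ (C1_ub y0))// divr_gt0.
have cardS : #|{: {x : hOmega | x \in Omega}}| = #|Omega|.
  by rewrite card_sig; apply: fintype.eq_card => x; rewrite inE.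
have S0 : (0 < #|Omega|)%N by rewrite -cardS; apply/card_gt0P; exists y0.
have [S1|S1] := leqP #|Omega| 1.
  have S_eq : #|Omega| = 1%N by apply/eqP; rewrite eqn_leq S1.
  split=> [i|].
    rewrite S_eq leqn0 => /eqP ->.
    rewrite (beta0 K_kernel K_reversible mu_gt0); last first.
      by rewrite (leq_trans S0)// max_card.
    by rewrite (beta0 Q_kernel Q_reversible nu_gt0) ?cardS// subrr mulr0.
  (* On a singleton every function is constant and has zero entropy, so the infimum for [Q] runs
     over the empty set. *)
  rewrite [leRHS](_ : _ = +oo%E) ?leey//.
  rewrite /log_sobolev [X in [set _ | _ in X]](_ : _ = set0) ?image_set0 ?ereal_inf0//.
  apply/seteqP; split=> // f /=; apply/negP; rewrite negbK; apply/eqP.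
  have -> : f = fun=> f y0.
    apply/funext => y; congr f.
    have /fintype_le1P : (#|{: {x : hOmega | x \in Omega}}| <= 1)%N by rewrite cardS.
    by move=> /(_ y0 y).
  exact: entropy2_const.
have C3_gt0 : 0 < C3.
  have [y1 y10] : exists y1, y1 != y0.
    apply/existsP; apply: contraTT S1 => /existsPn no.
    rewrite -leqNgt -cardS; apply/fintype_le1P => x y.
    by have := no x; have := no y; rewrite !negbK => /eqP -> /eqP ->.
  (* Any extension of this indicator separates [y0] from [y1], so its [K]-energy is positive;
     [C3_bound] then excludes [C3 <= 0]. *)
  pose f y : R := (y == y0)%:R.
  have Ef : 0 <= dirichlet Q nu f by exact: dirichlet_ge0.
  have EMf : 0 < dirichlet K mu (M f).
    rewrite lt_def dirichlet_ge0// andbT; apply/eqP => E0.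
    have := dirichlet0_const K_kernel K_irreducible mu_gt0 E0 (val y0) (val y1).
    rewrite !M_extension /f eqxx (negbTE y10) => /eqP.
    by rewrite oner_eq0.
  have := lt_le_trans EMf (C3_bound f); rewrite ltNge => CE.
  rewrite ltNge; apply: contra CE => C3_le0; exact: mulr_le0_ge0.
have CC : 0 < C1 * C3 by rewrite mulr_gt0.
split=> [i iO|].
  have iO' : (i < #|Omega|)%N by rewrite -(prednK S0) -subn1 ltnS.
  rewrite ler_pdivrMl//.
  apply: (beta_comparison K_kernel K_reversible mu_gt0 Q_kernel Q_reversible nu_gt0
    nu_le iO' (ltW C1_gt0) (ltW C3_gt0)).
  move=> h h_lap; apply: le_trans (C3_bound _).
  apply: (harmonic_min K_kernel K_reversible mu_gt0 h_lap) => x.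
  rewrite !inE negbK => xO; exact/esym/(M_extension _ (exist _ x xO)).
apply: le_ereal_inf_tmp => _ [f /= Lf <-].
have /andP[Lf0 Lle] := entropy2_comparison mu_gt0 nu_gt0 nu_le (ltW C1_gt0) mu1 nu1
  (M_extension f) Lf.
have LM0 : 0 < entropy2 mu (M f).
  by rewrite -(pmulr_rgt0 _ C1_gt0) (lt_le_trans Lf0).
have infle : (log_sobolev K mu <=
    (dirichlet K mu (M f) / entropy2 mu (M f))%:E)%E.
  by apply: ereal_inf_lbound; exists (M f) => //=; rewrite gt_eqF.
apply: le_trans (lee_wpmul2l _ infle) _; first by rewrite lee_fin invr_ge0 ltW.
rewrite -EFinM lee_fin ler_pdivrMl// ler_pdivrMr//.
apply: (le_trans (C3_bound f)).
have CEf : 0 <= C3 * dirichlet Q nu f.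
  by rewrite mulr_ge0 ?dirichlet_ge0// ltW.
(* The last factor is at least 1 by the entropy comparison, and it multiplies a nonnegative
   quantity. *)
rewrite [leRHS](_ : _ = C3 * dirichlet Q nu f * (C1 * entropy2 mu (M f) / entropy2 nu f));
  last ring.
by rewrite ler_peMr// ler_pdivlMr// mul1r.
Qed.
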